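(* Let $G$ be a $k$-contraction-critical graph. Then: (1) if $k\ge 17$, then $G$ is $8$-connected; (2) if $k\ge 29$, then $G$ is $9$-connected; (3) if $k\ge 41$, then $G$ is $10$-connected. It follows that $h(k)\ge 8$ for $k\ge 17$, $h(k)\ge 9$ for $k\ge 29$, and $h(k)\ge 10$ for $k\ge 41$.
   Context: Graphs are finite and simple. A graph $H$ is a minor of a graph $G$ if $H$ can be obtained from a subgraph of $G$ by contracting edges; it is a proper minor if it is a minor other than $G$ itself. A graph $G$ is $k$-contraction-critical if $G$ is $k$-chromatic (its chromatic number is exactly $k$) but every proper minor of $G$ is $(k-1)$-colorable. A graph is $m$-connected if it has more than $m$ vertices and deleting any set of fewer than $m$ vertices leaves a connected graph. The quantity $h(k)$ is the largest integer such that every noncomplete $k$-contraction-critical graph is $h(k)$-connected; the inequality $h(k)\ge m$ is read as: every noncomplete $k$-contraction-critical graph is $m$-connected. *)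

(* Defs.v *)
From mathcomp Require Import all_boot.
From Stdlib Require Import Relation_Operators.
Set Implicit Arguments.
Unset Strict Implicit.
Unset Printing Implicit Defensive.

Record sgraph := SGraph {
  vertex :> finType;
  adj : rel vertex;
  adj_sym : symmetric adj;
  adj_irrefl : irreflexive adj }.

Notation "x -- y" := (adj x y) (at level 30).

Definition isomorphic (G H : sgraph) : Prop :=
  exists2 f : G -> H, bijective f & forall x y, (f x -- f y) = (x -- y).

Definition complete (G : sgraph) : Prop := forall x y : G, x != y -> x -- y.

(* Subgraphs, contractions and minors are taken up to isomorphism. *)
Definition subgraph (H G : sgraph) : Prop :=
  exists2 f : H -> G, injective f & forall x y, x -- y -> f x -- f y.

(* H is G/xy for some edge xy: f is the quotient map identifying exactly x
   with y; the resulting loop and parallel edges are discarded. *)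
Definition edge_contraction (G H : sgraph) : Prop :=
  exists (x y : G) (f : G -> H),
    [/\ x -- y,
        forall a, exists u, f u = a,
        forall u v, f u = f v <-> [\/ u = v, u = x /\ v = y | u = y /\ v = x]
      & forall a b, a -- b <->
          a <> b /\ exists u v, [/\ f u = a, f v = b & u -- v]].

Definition minor (H G : sgraph) : Prop :=
  exists2 S, subgraph S G & clos_refl_trans sgraph edge_contraction S H.

Definition proper_minor (H G : sgraph) : Prop :=
  minor H G /\ ~ isomorphic H G.

Definition colorable (k : nat) (G : sgraph) : bool :=
  [exists c : {ffun G -> 'I_k}, forall x, forall y, (x -- y) ==> (c x != c y)].

Lemma colorable_ex (G : sgraph) : exists k, colorable k G.
Proof.
exists #|G|; apply/existsP; exists [ffun x => enum_rank x].
apply/forallP => x; apply/forallP => y; apply/implyP => xy.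
rewrite !ffunE; apply/eqP => /enum_rank_inj eq_xy.
by rewrite eq_xy adj_irrefl in xy.
Qed.

Definition chromatic_number (G : sgraph) : nat := ex_minn (colorable_ex G).

Definition contraction_critical (k : nat) (G : sgraph) : Prop :=
  chromatic_number G = k /\ forall H, proper_minor H G -> colorable k.-1 H.

Section Delete.
Variables (G : sgraph) (S : {set G}).

Definition delete_adj : rel {x : G | x \notin S} := fun x y => val x -- val y.

Lemma delete_adj_sym : symmetric delete_adj.
Proof. by move=> x y; apply: adj_sym. Qed.

Lemma delete_adj_irrefl : irreflexive delete_adj.
Proof. by move=> x; apply: adj_irrefl. Qed.

Definition delete : sgraph := SGraph delete_adj_sym delete_adj_irrefl.
End Delete.

Definition connected (G : sgraph) : Prop :=
  0 < #|G| /\ forall x y : G, connect (@adj G) x y.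

Definition m_connected (m : nat) (G : sgraph) : Prop :=
  m < #|G| /\ forall S : {set G}, #|S| < m -> connected (delete S).

(* The inequality h(k) >= m, where h(k) is the largest m such that every
   noncomplete k-contraction-critical graph is m-connected. No noncomplete
   k-contraction-critical graph need exist, in which case h(k) has no finite
   value but the inequality holds for all m. *)
Definition h_ge (k m : nat) : Prop :=
  forall G, contraction_critical k G -> ~ complete G -> m_connected m G.

(* Main.v *)
(* Let [S] be a minimum separator of [G], [B] a component of [G - S], [L] the complement of
   [B], and [I] a largest independent subset of [S].  Contracting [B] and [I] to one vertex
   gives a (k-1)-coloring [c] of [L] in which [I] is exactly one color class of [S]; take one
   with the most colors on [R = S \ I].  For every independent subset [X] of [R] with at
   least two elements reserve a color [b X] unused on [S].  From the color classes [T_a] of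
   [R] grow disjoint connected sets [V_a], where [V_a] may use the color [a] and the colors
   [b X] with [T_a] included in [X]; by the choice of [c], Kempe changes show that a maximal
   [V_a] contains [T_a].  Contract the [V_a] and the components of what remains of [L], and
   color the resulting minor, which still contains [B], with k-1 colors.  Whenever this
   coloring gives the same color to several [T_a] with union [X], the sets [V_a] are pairwise
   nonadjacent and closed under Kempe changes between [a] and [b X], so [c] can be changed on
   [L] so that all of [X] gets the color [b X]; the vertices of [I] can be adjusted in the
   same way.  The two colorings then agree on [S], and [G] is (k-1)-colorable.  This needs
   |S| colors plus the number of sets [X], which is at most 16, 28 or 40 for |S| <= 7, 8, 9. *)

Require Import Defs.
From mathcomp Require Import all_boot perm zify.
From Stdlib Require Import Relation_Operators.
Set Implicit Arguments.
Unset Strict Implicit.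
Unset Printing Implicit Defensive.

(** * Paths in finite relations *)

Lemma connect_mono_map (T T' : finType) (e : rel T) (e' : rel T') (h : T -> T') :
  (forall u v, e u v -> connect e' (h u) (h v)) ->
  forall u v, connect e u v -> connect e' (h u) (h v).
Proof.
move=> he u v /connectP[p]; elim: p u => [|w p IHp] u /=; first by move=> _ ->.
by case/andP=> /he uw wp vE; apply: connect_trans uw (IHp _ wp vE).
Qed.

Lemma connect_exit (T : finType) (e : rel T) (P : pred T) u v :
  connect e u v -> P u -> ~~ P v -> exists a b, [/\ connect e u a, e a b, P a & ~~ P b].
Proof.
move=> /connectP[p]; elim: p u => [|w p IHp] u /=; first by move=> _ -> ->.
case/andP=> uw wp vE Pu Pv; case: (boolP (P w)) => Pw; last first.
  by exists u, w; split.
have [a [b [wa ab Pa Pb]]] := IHp _ wp vE Pw Pv.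
by exists a, b; split=> //; apply: connect_trans wa; apply: connect1.
Qed.

Lemma connect_restrict (T : finType) (e : rel T) (P : pred T) u v :
  (forall a b, e a b -> P a -> P b) -> P u -> connect e u v ->
  connect (fun a b => [&& e a b, P a & P b]) u v.
Proof.
move=> eP Pu /connectP[p]; elim: p u Pu => [|x p IHp] u Pu /=; first by move=> _ ->.
case/andP=> ux xp vE; have Px := eP _ _ ux Pu.
by apply: connect_trans (IHp _ Px xp vE); apply: connect1; rewrite ux Pu Px.
Qed.

(** * Contracting connected fibers *)

Section EdgeContraction.
Variables (G : sgraph) (x y : G) (xy : x -- y).

Definition merge_vertex (z : G) : G := if z == y then x else z.

Lemma merge_vertex_neq z : merge_vertex z != y.
Proof.
rewrite /merge_vertex; case: ifPn => // _.
by apply: contraTneq xy => ->; rewrite adj_irrefl.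
Qed.

Definition contraction_map z : {z : G | z != y} :=
  exist (fun w : G => w != y) (merge_vertex z) (merge_vertex_neq z).

Definition contraction_adj (a b : {z : G | z != y}) :=
  (a != b) && [exists u, exists v,
    [&& contraction_map u == a, contraction_map v == b & u -- v]].

Lemma contraction_adj_sym : symmetric contraction_adj.
Proof.
suff sub a b : contraction_adj a b -> contraction_adj b a.
  by move=> a b; apply/idP/idP; apply: sub.
case/andP=> ab /existsP[u /existsP[v /and3P[ua vb uv]]].
rewrite /contraction_adj eq_sym ab; apply/existsP; exists v; apply/existsP; exists u.
by rewrite ua vb adj_sym uv.
Qed.

Lemma contraction_adj_irrefl : irreflexive contraction_adj.
Proof. by move=> a; rewrite /contraction_adj eqxx. Qed.

Definition contraction := SGraph contraction_adj_sym contraction_adj_irrefl.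

Lemma contraction_mapK (a : contraction) : contraction_map (val a) = a.
Proof.
by apply: val_inj; rewrite /= /merge_vertex (negPf (valP a)).
Qed.

Lemma contraction_adjP (a b : contraction) :
  a -- b <-> a <> b /\ exists u v, [/\ contraction_map u = a, contraction_map v = b & u -- v].
Proof.
split=> [/andP[/eqP ab /existsP[u /existsP[v /and3P[/eqP ua /eqP vb uv]]]]|].
  by split=> //; exists u, v.
case=> /eqP ab [u [v [ua vb uv]]]; apply/andP; split=> //.
by apply/existsP; exists u; apply/existsP; exists v; rewrite ua vb !eqxx.
Qed.

Lemma contraction_mapE u v : contraction_map u = contraction_map v <->
  [\/ u = v, u = x /\ v = y | u = y /\ v = x].
Proof.
have xNy : x == y = false by apply: contraTF xy => /eqP->; rewrite adj_irrefl.
split=> [/(congr1 val) /=|]; last first.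
  case=> [->//|[-> ->]|[-> ->]]; apply: val_inj => /=;
  by rewrite /merge_vertex eqxx xNy.
rewrite /merge_vertex; case: eqP => [->|_]; case: eqP => [->|_] => // E;
  by [apply: Or31 | apply: Or32 | apply: Or33].
Qed.

Lemma edge_contractionP : edge_contraction G contraction.
Proof.
exists x, y, contraction_map; split=> //.
- by move=> a; exists (val a); apply: contraction_mapK.
- exact: contraction_mapE.
- exact: contraction_adjP.
Qed.

Lemma card_contraction : #|contraction| < #|G|.
Proof.
rewrite -[X in _ < X]cardsT card_sub; apply: proper_card; apply/properP.
split; first by apply/subsetP => z; rewrite inE.
by exists y; rewrite ?inE ?eqxx.
Qed.

End EdgeContraction.

Definition fiber_rel (G : sgraph) (L : eqType) (f : G -> L) : rel G :=
  fun u v => (u -- v) && (f u == f v).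

(** Only the kernel of [f] enters, so the label type can stay fixed while the graph shrinks by
    successive contractions. *)
Definition is_quotient (G H : sgraph) (L : Type) (f : G -> L) (q : G -> H) :=
  [/\ forall a, exists u, q u = a,
      forall u v, q u = q v <-> f u = f v
    & forall a b, a -- b <-> a <> b /\ exists u v, [/\ q u = a, q v = b & u -- v]].

(** While some edge has both ends in one fiber, contract it: [f] descends to the contraction and its
    fibers stay connected. When no such edge is left, connectedness makes [f] injective, and [G] is
    its own quotient. *)
Lemma contract_fibers (L : eqType) n (G : sgraph) (f : G -> L) : #|G| <= n ->
  (forall u v, f u = f v -> connect (fiber_rel f) u v) ->
  exists (H : sgraph) (q : G -> H),
    clos_refl_trans sgraph edge_contraction G H /\ is_quotient f q.
Proof.
elim: n G f => [|n IHn] G f Gn fconn.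
  exists G, id; split; first exact: rt_refl.
  have noG (u : G) : False by move: Gn; rewrite leqn0 => /eqP/card0_eq/(_ u).
  by split=> u; case: (noG u).
case: (boolP [exists x, exists y, fiber_rel f x y]) => [/existsP[x /existsP[y /andP[xy /eqP fxy]]]|noedge].
  pose p := contraction_map xy; pose f1 (a : contraction xy) := f (val a).
  have f1p u : f1 (p u) = f u.
    by rewrite /f1 /p /= /merge_vertex; case: eqP => [->|].
  have [||H [q [GH [qsurj qE qadj]]]] := IHn (contraction xy) f1.
  - by rewrite -ltnS; apply: leq_trans Gn; apply: card_contraction.
  - move=> a b fab.
    rewrite -(contraction_mapK a) -(contraction_mapK b).
    apply: (@connect_mono_map _ _ (fiber_rel f) _ p); last exact: fconn.
    move=> u v /andP[uv fuv]; case: (eqVneq (p u) (p v)) => [-> //|puv].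
    apply: connect1; rewrite /fiber_rel !f1p fuv andbT.
    by apply/contraction_adjP; split; [apply/eqP | exists u, v].
  exists H, (q \o p); split.
    by apply: rt_trans GH; apply: rt_step; apply: edge_contractionP.
  split=> [a|u v|a b].
  - by have [u <-] := qsurj a; exists (val u); rewrite /= /p contraction_mapK.
  - by apply: (iff_trans (qE _ _)); rewrite !f1p.
  - apply: (iff_trans (qadj _ _)); split=> -[ab [u [v [ua vb uv]]]]; split=> //.
      have /contraction_adjP[_ [u' [v' [u'u v'v uv']]]] := uv.
      by exists u', v'; rewrite /= /p u'u v'v.
    exists (p u), (p v); split=> //; apply/contraction_adjP; split; last by exists u, v.
    by move=> puv; apply: ab; rewrite -ua -vb /= puv.
exists G, id; split; first exact: rt_refl.
split=> [a|u v|a b]; first by exists a.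
- split=> [-> //|/fconn/connectP[[|w p] /=]]; first by move=> _ ->.
  by case/andP=> uw; case/existsP: noedge; exists u; apply/existsP; exists w.
- split=> [ab|[_ [u [v [<- <- //]]]]]; split; last by exists a, b.
  by move=> abE; rewrite abE adj_irrefl in ab.
Qed.

(** * Criticality as a coloring principle *)

Section Induced.
Variables (G : sgraph) (W : {set G}).
Definition induced_adj : rel {x : G | x \in W} := fun u v => val u -- val v.
Lemma induced_adj_sym : symmetric induced_adj.
Proof. by move=> u v; apply: adj_sym. Qed.
Lemma induced_adj_irrefl : irreflexive induced_adj.
Proof. by move=> u; apply: adj_irrefl. Qed.
Definition induced : sgraph := SGraph induced_adj_sym induced_adj_irrefl.
End Induced.

(** The form in which criticality is used: delete the vertices outside [W], contract the fibers of
    [f], color the resulting proper minor and pull the coloring back to [g]. Later arguments can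
    then stay inside [G]. *)
Definition contraction_colorable (N : nat) (G : sgraph) :=
  forall (L : eqType) (W : {set G}) (f : G -> L),
  {in W &, forall u v, f u = f v ->
     connect (fun a b => [&& a -- b, a \in W, b \in W & f a == f b]) u v} ->
  (exists v, v \notin W) \/ (exists u v, [/\ u \in W, v \in W, u != v & f u = f v]) ->
  exists g : G -> 'I_N,
    {in W &, forall u v, f u = f v -> g u = g v} /\
    {in W &, forall u v, u -- v -> f u <> f v -> g u <> g v}.

Lemma critical_contraction_colorable k (G : sgraph) :
  contraction_critical k G -> 0 < k.-1 -> contraction_colorable k.-1 G.
Proof.
move=> [_ crit] k0 L W f fconn noninj.
have k1 : 'I_k.-1 by exists 0.
pose f' (u : induced W) := f (val u).
have [||H [q [GH [qsurj qE qadj]]]] := @contract_fibers _ #|induced W| (induced W) f'; first by [].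
  move=> u v fuv; have := fconn _ _ (valP u) (valP v) fuv.
  pose h (z : G) : induced W := insubd u z.
  have hval (z : induced W) : h (val z) = z by rewrite /h valKd.
  move=> cuv; rewrite -(hval u) -(hval v); apply: connect_mono_map cuv.
  move=> a b /and4P[ab aW bW fab]; apply: connect1.
  have va : val (h a) = a by rewrite /h insubdK.
  have vb : val (h b) = b by rewrite /h insubdK.
  by rewrite /fiber_rel /f' va vb fab andbT /= /induced_adj va vb.
(* The minor is proper because it has fewer vertices: either [W] misses a vertex or the quotient map
   identifies two. *)
have cardH : #|H| < #|G|.
  have HE : #|H| = #|q @: [set: induced W]|.
    rewrite -cardsT; congr #|pred_of_set _|; apply/setP => a; rewrite inE.
    by have [u <-] := qsurj a; rewrite imset_f.
  have HW : #|H| <= #|induced W| by rewrite HE -[X in _ <= X]cardsT leq_imset_card.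
  case: noninj => [[v vW]|[u [v [uW vW uv fuv]]]].
    apply: leq_ltn_trans HW _.
    rewrite card_sub -[X in _ < X]cardsT; apply: proper_card; apply/properP.
    split; first by apply/subsetP => z; rewrite inE.
    by exists v; rewrite ?inE.
  apply: (@leq_trans #|induced W|); last by rewrite card_sub max_card.
  rewrite ltn_neqAle HW andbT HE -cardsT; apply/imset_injP => qinj.
  pose u' : induced W := exist (fun x => x \in W) u uW.
  pose v' : induced W := exist (fun x => x \in W) v vW.
  have /(congr1 val) /= uvE : u' = v' by apply: qinj; rewrite ?inE //; apply/qE.
  by rewrite uvE eqxx in uv.
have /existsP[col /forallP colP] : colorable k.-1 H.
  apply: crit; split.
    exists (induced W) => //; exists val; [exact: val_inj | by []].
  by case=> h [h' hK h'K] _; rewrite (bij_eq_card (Bijective hK h'K)) ltnn in cardH.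
exists (fun u => if insub u is Some u' then col (q u') else k1); split=> u v uW vW.
  move=> fuv; rewrite (insubT (fun x => x \in W) uW) (insubT (fun x => x \in W) vW).
  by congr (col _); apply/qE.
move=> uv fuv; rewrite (insubT (fun x => x \in W) uW) (insubT (fun x => x \in W) vW).
apply/eqP; set u' := Sub u uW; set v' := Sub v vW.
have := colP (q u') => /forallP/(_ (q v'))/implyP; apply.
apply/qadj; split; first by move/qE.
by exists u', v'; split.
Qed.

(** * Extending injections *)

Lemma injection_into (T U : finType) (P : {set T}) (Q : {set U}) (u0 : U) :
  #|P| <= #|Q| -> exists f : T -> U, {in P &, injective f} /\ {in P, forall x, f x \in Q}.
Proof.
move=> PQ; have rk x : x \in P -> index x (enum P) < size (enum Q).
  by move=> xP; rewrite -cardE; apply: leq_trans PQ; rewrite cardE index_mem mem_enum.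
exists (fun x => nth u0 (enum Q) (index x (enum P))); split=> [x y xP yP /eqP|x xP].
  rewrite nth_uniq ?rk ?enum_uniq // => /eqP/(congr1 (nth x (enum P))).
  by rewrite !nth_index ?mem_enum.
by rewrite -mem_enum mem_nth ?rk.
Qed.

Lemma perm_extending (T : finType) (P : {set T}) (f : T -> T) :
  {in P &, injective f} -> exists s : {perm T}, {in P, s =1 f}.
Proof.
move=> finj; case: (pickP T) => [t0 _|T0]; last by exists 1%g => x; have := T0 x.
have cardC : #|~: P| <= #|~: (f @: P)|.
  by rewrite -(leq_add2l #|P|) cardsC -(card_in_imset finj) cardsC.
have [h [hinj hP]] := injection_into t0 cardC.
pose g x := if x \in P then f x else h x.
have ginj : injective g.
  move=> x y; rewrite /g; case: ifPn => xP; case: ifPn => yP.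
  - exact: finj.
  - by move=> E; have := hP y; rewrite !inE => /(_ yP); rewrite -E imset_f.
  - by move=> E; have := hP x; rewrite !inE => /(_ xP); rewrite E imset_f.
  - by apply: hinj; rewrite inE.
by exists (perm ginj) => x xP; rewrite permE /g xP.
Qed.

(** * Growing disjoint connected sets *)

Section Ownership.
Variables (G : sgraph) (N : nat) (c : G -> 'I_N) (L R : {set G}).
Variables (XX : {set {set G}}) (b : {set G} -> 'I_N).

Definition color_part (a : 'I_N) : {set G} := [set x in R | c x == a].

Definition admissible (a : 'I_N) (v : G) :=
  (c v == a) || [exists X in XX, (c v == b X) && (color_part a \subset X)].

Definition owner_rel (w : G -> option 'I_N) (a : 'I_N) : rel G :=
  fun u v => [&& u -- v, w u == Some a & w v == Some a].

(** [w v = Some a] encodes that [v] lies in V_a, so the V_a are disjoint by construction. Only one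
    vertex of T_a is required to lie in V_a; for a suitable [c], closedness later forces in the
    others ([owner_part]). *)
Definition valid_owner (w : G -> option 'I_N) :=
  [/\ forall a, a \in c @: R -> exists x, [/\ x \in R, c x = a & w x = Some a],
      forall v a, w v = Some a -> [/\ v \in L, a \in c @: R & admissible a v]
    & forall u v a, w u = Some a -> w v = Some a -> connect (owner_rel w a) u v].

Definition closed_owner (w : G -> option 'I_N) :=
  forall u v a, w u = Some a -> u -- v -> v \in L -> admissible a v -> w v <> None.

(** A violation of closedness is an unowned vertex that can be attached to a neighboring V_a; each
    attachment lowers the number of unowned vertices. *)
Lemma exists_closed_owner w : valid_owner w ->
  exists w', valid_owner w' /\ closed_owner w'.
Proof.
have [n] := ubnP #|[set v | w v == None]|; elim: n w => // n IHn w wn vw.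
case: (boolP [exists u, exists v, exists a,
         [&& w u == Some a, u -- v, v \in L, admissible a v & w v == None]]); last first.
  move=> no; exists w; split=> // u v a wu uv vL av wv; case/existsP: no.
  exists u; apply/existsP; exists v; apply/existsP; exists a.
  by rewrite wu uv vL av wv !eqxx.
case/existsP=> u /existsP[v /existsP[a /and5P[/eqP wu uv vL av /eqP wv]]].
case: vw => [w1 w2 w3].
pose w' z := if z == v then Some a else w z.
have sub z e : w z = Some e -> w' z = Some e.
  by rewrite /w'; case: eqP => // ->; rewrite wv.
have subc e x y : connect (owner_rel w e) x y -> connect (owner_rel w' e) x y.
  apply: (connect_mono_map (h := id)) => p q /and3P[pq /eqP wp /eqP wq]; apply: connect1.
  by rewrite /owner_rel pq (sub _ _ wp) (sub _ _ wq) eqxx.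
have w'v : w' v = Some a by rewrite /w' eqxx.
have w'v_inv z e : w' z = Some e -> z <> v -> w z = Some e.
  by rewrite /w'; case: eqP.
have sym e : connect_sym (owner_rel w' e).
  by apply: sym_connect_sym => p q; rewrite /owner_rel adj_sym [X in _ && X]andbC.
have uvc : connect (owner_rel w' a) u v.
  by apply: connect1; rewrite /owner_rel uv w'v (sub _ _ wu) eqxx.
apply: (IHn w').
  apply: leq_trans (_ : #|[set z | w' z == None]| < #|[set z | w z == None]|) wn.
  apply: proper_card; apply/properP; split; last by exists v; rewrite inE ?w'v ?wv.
  by apply/subsetP => z; rewrite !inE /w'; case: (z =P v) => [->|//]; rewrite wv.
split.
- by move=> e /w1[x [xR cx wx]]; exists x; split; rewrite ?(sub _ _ wx).
- move=> z e w'z; case: (eqVneq z v) => [zv|/eqP zv]; last by apply: w2; apply: w'v_inv.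
  by move: w'z; rewrite zv w'v => -[<-]; split=> //; case: (w2 _ _ wu).
- move=> x y e w'x w'y; case: (eqVneq x v) => [xv|/eqP xv].
    case: (eqVneq y v) => [-> //|/eqP yv]; first by rewrite xv.
    move: w'x; rewrite xv w'v => -[ae]; subst e; rewrite sym.
    by apply: connect_trans uvc; apply: subc; apply: w3 => //; apply: w'v_inv.
  have wx := w'v_inv _ _ w'x xv.
  case: (eqVneq y v) => [yv|/eqP yv].
    move: w'y; rewrite yv w'v => -[ae]; subst e.
    by apply: connect_trans uvc; apply: subc; apply: w3.
  by apply: subc; apply: w3 => //; apply: w'v_inv.
Qed.

Lemma exists_owner : R \subset L -> exists w, valid_owner w /\ closed_owner w.
Proof.
move=> RL; pose rep a := [pick x | (x \in R) && (c x == a)].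
pose w z := if rep (c z) == Some z then Some (c z) else None.
have wE z a : w z = Some a -> c z = a /\ rep a = Some z.
  by rewrite /w; case: eqP => // E [<-].
have repE a z : rep a = Some z -> z \in R /\ c z = a.
  by rewrite /rep; case: pickP => // x /andP[xR /eqP cx] [<-].
apply: (@exists_closed_owner w); split.
- move=> a /imsetP[x xR ->].
  have : isSome (rep (c x)).
    by rewrite /rep; case: pickP => // /(_ x); rewrite xR eqxx.
  case E: (rep (c x)) => [z|] // _; have [zR cz] := repE _ _ E.
  by exists z; split=> //; rewrite /w cz E eqxx.
- move=> v a /wE[cv /repE[vR _]]; split; first exact: (subsetP RL).
    by rewrite -cv imset_f.
  by rewrite /admissible cv eqxx.
- by move=> u v a /wE[_ ru] /wE[_]; rewrite ru => -[->].
Qed.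

End Ownership.

(** A transposed color stays in its own pair: [x] moves at most within [p], [q], which avoid [y],
    [p'] and [q'], and likewise for [y]. *)
Lemma tperm_neq (T : finType) (p q p' q' x y : T) :
  x <> y -> y <> p -> y <> q -> x <> p' -> x <> q' ->
  p <> p' -> p <> q' -> q <> p' -> q <> q' -> tperm p q x <> tperm p' q' y.
Proof. by do 9!move=> ?; case: tpermP => *; case: tpermP => * //; congruence. Qed.

Definition independent (G : sgraph) (X : {set G}) :=
  [forall u in X, forall v in X, ~~ (u -- v)].

Lemma independentP (G : sgraph) (X : {set G}) :
  reflect (forall u v, u \in X -> v \in X -> ~~ (u -- v)) (independent X).
Proof.
apply: (iffP forall_inP) => [H u v uX vX|H u uX].
  by have /forall_inP/(_ _ vX) := H _ uX.
by apply/forall_inP => v vX; apply: H.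
Qed.

Definition independent_sets (G : sgraph) (R : {set G}) : {set {set G}} :=
  [set X : {set G} | [&& X \subset R, 1 < #|X| & independent X]].

(** * Gluing colorings along a separator *)

Section Gluing.
Variables (G : sgraph) (N : nat) (B L S R I : {set G}) (i0 : 'I_N).
Hypothesis contr : contraction_colorable N G.
Hypothesis separated : forall u v, u \in B -> v \notin B -> v \notin S -> ~~ (u -- v).
Hypothesis LE : L = ~: B.
Hypothesis RE : R = S :\: I.
Hypothesis BS : [disjoint B & S].
Hypothesis IS : I \subset S.
Hypothesis nonempty_side : exists a, a \notin B /\ a \notin S.


(** The values on [B] are left free; total finite functions make it possible to take a maximum over
    all such colorings. *)
Definition exact_coloring (c : {ffun G -> 'I_N}) :=
  [&& [forall u in L, forall v in L, (u -- v) ==> (c u != c v)],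
      [forall x in I, c x == i0] & [forall x in R, c x != i0]].

Lemma exact_coloringP (c : {ffun G -> 'I_N}) :
  reflect [/\ forall u v, u \in L -> v \in L -> u -- v -> c u <> c v,
              forall x, x \in I -> c x = i0
            & forall x, x \in R -> c x <> i0] (exact_coloring c).
Proof.
apply: (iffP and3P) => [[cL cI cR]|[cL cI cR]]; split.
- by move=> u v uL vL uv; have /forall_inP/(_ _ uL)/forall_inP/(_ _ vL)/implyP/(_ uv)/eqP := cL.
- by move=> x xI; have /forall_inP/(_ _ xI)/eqP := cI.
- by move=> x xR; have /forall_inP/(_ _ xR)/eqP := cR.
- apply/forall_inP => u uL; apply/forall_inP => v vL; apply/implyP => uv.
  by apply/eqP; apply: cL.
- by apply/forall_inP => x xI; rewrite cI.
- by apply/forall_inP => x xR; apply/eqP; apply: cR.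
Qed.

Let SL : S \subset L.
Proof. by rewrite LE -disjoints_subset disjoint_sym. Qed.

Let RS x : x \in R -> x \in S.
Proof. by rewrite RE => /setDP[]. Qed.

Let SE x : x \in S -> (x \in I) \/ (x \in R).
Proof. by move=> xS; case: (boolP (x \in I)) => xI; [left | right; rewrite RE; apply/setDP]. Qed.

(** * Owned sets of a coloring with the most colors on [R] *)

Section WithColoring.
Variable c : {ffun G -> 'I_N}.
Hypothesis c_exact : exact_coloring c.
Hypothesis c_max : forall c', exact_coloring c' -> #|c' @: R| <= #|c @: R|.
(* [b X] is reserved for recoloring [X], and [E] for the classes contained in [I]. *)
Variables (b : {set G} -> 'I_N) (E : {set 'I_N}).
Let XX := independent_sets R.
Hypothesis b_inj : {in XX &, injective b}.
Hypothesis bR : forall X, X \in XX -> b X \notin c @: R.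
Hypothesis bi0 : forall X, X \in XX -> b X <> i0.
Hypothesis ER : forall a, a \in E -> a \notin c @: R.
Hypothesis Eb : forall X, X \in XX -> b X \notin E.
Hypothesis cardE : #|I| <= #|E|.
Variable w : G -> option 'I_N.
Hypothesis w_valid : valid_owner c L R XX b w.
Hypothesis w_closed : closed_owner c L R XX b w.

Let cL u v : u \in L -> v \in L -> u -- v -> c u <> c v.
Proof. by case/exact_coloringP: c_exact => + _ _; apply. Qed.

Let cI x : x \in I -> c x = i0.
Proof. by case/exact_coloringP: c_exact => _ + _; apply. Qed.

Let cR x : x \in R -> c x <> i0.
Proof. by case/exact_coloringP: c_exact => _ _; apply. Qed.

Let i0R : i0 \notin c @: R.
Proof. by apply/imsetP => -[x /cR + E']; rewrite -E'. Qed.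

Let T := color_part c R.

Let T_in a : a \in c @: R -> exists2 x, x \in R & c x = a.
Proof. by case/imsetP=> x xR ->; exists x. Qed.

Let owner_color v a : w v = Some a ->
  c v = a \/ exists X, [/\ X \in XX, c v = b X & T a \subset X].
Proof.
case: w_valid => _ w2 _ /w2[_ _]; case/orP=> [/eqP|]; first by left.
by case/existsP=> X /and3P[XX_X /eqP cv TX]; right; exists X.
Qed.

Let owner_L v a : w v = Some a -> v \in L.
Proof. by case: w_valid => _ w2 _ /w2[]. Qed.

Let owner_R v a : w v = Some a -> a \in c @: R.
Proof. by case: w_valid => _ w2 _ /w2[]. Qed.

Let owner_own v a : w v = Some a -> c v \in c @: R -> a = c v.
Proof.
move=> /owner_color[//|[X [XX_X cv _]]]; rewrite cv => bXR.
by have := bR XX_X; rewrite bXR.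
Qed.

Let owner_b v a X : w v = Some a -> X \in XX -> c v = b X -> T a \subset X.
Proof.
move=> wv XX_X cv; case: (owner_color wv) => [E'|[X' [XX_X' cv' TX']]].
  by have := bR XX_X; rewrite -cv E' (owner_R wv).
by rewrite (b_inj XX_X XX_X') // -cv.
Qed.

Let owner_i0 v a : w v = Some a -> c v <> i0.
Proof.
move=> wv; case: (owner_color wv) => [-> E'|[X [XX_X -> _]]]; last exact: bi0.
by have := i0R; rewrite -E' (owner_R wv).
Qed.

Let owner_E v a : w v = Some a -> c v \notin E.
Proof.
move=> wv; case: (owner_color wv) => [->|[X [XX_X -> _]]]; last exact: Eb.
by apply/negP => /ER; rewrite (owner_R wv).
Qed.

Let color_part_indep a : 1 < #|T a| -> T a \in XX.
Proof.
move=> Ta; rewrite inE Ta /=; apply/andP; split.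
  by apply/subsetP => x; rewrite inE => /andP[].
apply/independentP => x y; rewrite !inE => /andP[xR /eqP cx] /andP[yR /eqP cy].
apply/negP => /cL; rewrite cx cy; apply=> //; apply: (subsetP SL); exact: RS.
Qed.

(* Otherwise swapping the two colors on the component of [t] would give an exact
   coloring using one more color on [R]. *)
Let kempe_part a t x : t \in R -> x \in R -> c t = a -> c x = a -> T a \in XX ->
  connect (fun u v => [&& u -- v, v \in L & (c v == a) || (c v == b (T a))]) t x.
Proof.
move=> tR xR ct cx XXa; set d := b (T a); set k := fun u v => _; apply/negPn/negP => ntx.
pose C := [set v | connect k t v].
have aR : a \in c @: R by rewrite -ct imset_f.
have dR : d \notin c @: R by apply: bR.
have CE v : v \in C -> (c v == a) || (c v == d).
  rewrite inE => tv; apply/negPn/negP => ncv.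
  have [|u [z [_ /and3P[_ _ kz]]]] := connect_exit (P := fun v => (c v == a) || (c v == d)) tv _ ncv.
    by rewrite ct eqxx.
  by move=> _; rewrite kz.
pose c2 : {ffun G -> 'I_N} := [ffun v => if v \in C then tperm a d (c v) else c v].
have c2L u v : u \in L -> v \in L -> u -- v -> u \in C -> c2 u <> c2 v.
  move=> uL vL uv uC; rewrite !ffunE uC; case: ifPn => vC.
    by move/perm_inj; apply: cL.
  have ncv : ~~ ((c v == a) || (c v == d)).
    apply: contra vC => cv; move: uC; rewrite !inE => uC.
    by apply: connect_trans uC (connect1 _); rewrite /k uv vL cv.
  move: (CE _ uC) ncv; rewrite negb_or => /orP[]/eqP-> /andP[/eqP va /eqP vd].
    by rewrite tpermL => /esym.
  by rewrite tpermR => /esym.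
have c2_exact : exact_coloring c2.
  apply/exact_coloringP; split=> [u v uL vL uv|z zI|z zR].
  - case: (boolP (u \in C)) => uC; first exact: c2L.
    case: (boolP (v \in C)) => vC; last by rewrite !ffunE (negPf uC) (negPf vC); apply: cL.
    by move=> /esym; apply: c2L => //; rewrite adj_sym.
  - rewrite ffunE cI //; case: ifP => // _; apply: tpermD.
      by apply: contraTneq aR => ->.
    by apply/eqP; apply: bi0.
  - rewrite ffunE; case: ifP => _; last exact: cR.
    have <- : tperm a d i0 = i0.
      apply: tpermD; last by apply/eqP; apply: bi0.
      by apply: contraTneq aR => ->.
    by move/perm_inj; apply: cR.
have := c_max c2_exact; rewrite leqNgt => /negP; apply.
(* [t] takes the new color [d], [x] lies outside the component and keeps [a], and the swap fixes
   every other color of [R]. *)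
apply: proper_card; apply/properP; split; last first.
  exists d => //; apply/imsetP; exists t => //.
  by rewrite ffunE inE connect0 ct tpermL.
apply/subsetP => e /imsetP[y yR ->].
case: (eqVneq (c y) a) => [->|ya]; apply/imsetP.
  by exists x => //; rewrite ffunE inE (negPf ntx).
exists y => //; rewrite ffunE; case: ifP => // _; rewrite tpermD // eq_sym //.
by apply: contraNneq dR => <-; rewrite imset_f.
Qed.

(** Otherwise the Kempe chain to [x] from a vertex [t] of T_a in V_a leaves V_a at some [v].
    Closedness gives [v] an owner [l]. If [v] has color [a], then [l = a]; if it has color
    [b (T a)], then T_l is a nonempty subset of T_a, and again [l = a]. *)
Let owner_part x : x \in R -> w x = Some (c x).
Proof.
move=> xR; set a := c x; have aR : a \in c @: R by rewrite imset_f.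
case: w_valid => w1 _ _; have [t [tR ct wt]] := w1 _ aR.
apply/eqP/negPn/negP => wx; have tx : t != x by apply: contraNneq wx => <-; rewrite wt.
have XXa : T a \in XX.
  apply: color_part_indep; rewrite (cardD1 t) (cardD1 x) !inE tR xR ct eqxx.
  by rewrite (eq_sym x) tx.
have tcx := kempe_part tR xR ct erefl XXa.
have [|u [v [_ /and3P[uv vL kv] /eqP wu wv]]] := connect_exit (P := fun v => w v == Some a) tcx _ wx.
  by rewrite wt.
have adm : admissible c R XX b a v.
  case/orP: kv => kv; apply/orP; [by left | right].
  by apply/existsP; exists (T a); rewrite XXa kv subxx.
case wvE : (w v) => [l|]; last by case: (w_closed wu uv vL adm wvE).
case/eqP: wv; rewrite wvE; congr Some.
case/orP: kv => /eqP kv; first by rewrite -kv; apply: owner_own wvE _; rewrite kv.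
have /subsetP Tl := owner_b wvE XXa kv.
have [y yR cy] := T_in (owner_R wvE).
by have := Tl y; rewrite !inE yR cy eqxx => /(_ isT)/eqP.
Qed.

Let owner_I x : x \in I -> w x = None.
Proof.
by move=> xI; case wx: (w x) => [a|//]; case: (owner_i0 wx); apply: cI.
Qed.

(** * The contracted minor *)

Let Y : {set G} := [set v in L | w v == None].
Let piece_rel : rel G := fun u v => [&& u -- v, u \in Y & v \in Y].

Let piece_sym : connect_sym piece_rel.
Proof.
by apply: sym_connect_sym => u v; rewrite /piece_rel adj_sym [(u \in Y) && _]andbC.
Qed.

(** Names the vertex of the minor to which [v] is contracted. Vertices of [B] are isolated for
    [piece_rel], so each is its own root and stays uncontracted. *)
Let label (v : G) : 'I_N + G := if w v is Some a then inl a else inr (root piece_rel v).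

(** Fibers of [L] that miss [S] are deleted, so every color of [g] on the kept part of [L] occurs on
    [S] ([gW]), where [target] will be injective. *)
Let W : {set G} := B :|: [set v in L | [exists s in S, label s == label v]].

Let label_owner v a : w v = Some a -> label v = inl a.
Proof. by rewrite /label => ->. Qed.

Let label_piece u v : u -- v -> u \in Y -> v \in Y -> label u = label v.
Proof.
move=> uv uY vY; move: (uY) (vY); rewrite /label !inE => /andP[_ /eqP->] /andP[_ /eqP->].
by congr inr; apply/rootP => //; apply: connect1; rewrite /piece_rel uv uY vY.
Qed.

Let label_S x y : x \in S -> y \in S -> label x = label y -> c x = c y.
Proof.
move=> /SE[]xE /SE[]yE; rewrite /label ?(owner_I xE) ?(owner_I yE) ?(owner_part xE) ?(owner_part yE) //.
  by move=> _; rewrite !cI.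
by case.
Qed.

Let label_B u v : u \in B -> label u = label v -> u = v.
Proof.
move=> uB; have uL : u \notin L by rewrite LE inE uB.
rewrite /label; case wu: (w u) => [a|]; first by rewrite (owner_L wu) in uL.
case: (w v) => // -[/(rootP piece_sym)/connectP[[|x p] /=]]; first by move=> _ ->.
by case/andP=> /and3P[_ + _]; rewrite inE (negPf uL).
Qed.

Let W_label u v : u \in W -> u \in L -> v \in L -> label v = label u -> v \in W.
Proof.
rewrite !inE => /orP[uB|/andP[_ /existsP[s /andP[sS /eqP sE]]]] uL vL vu.
  by move: uL; rewrite LE inE uB.
by apply/orP; right; rewrite vL; apply/existsP; exists s; rewrite sS sE vu eqxx.
Qed.

Let SW x : x \in S -> x \in W.
Proof.
move=> xS; rewrite !inE; apply/orP; right.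
rewrite (subsetP SL _ xS) /=.
by apply/existsP; exists x; rewrite xS eqxx.
Qed.

Let W_S u : u \in W -> u \in L -> exists2 s, s \in S & label s = label u.
Proof.
rewrite !inE => /orP[uB|/andP[_ /existsP[s /andP[sS /eqP sE]]]] uL; last by exists s.
by move: uL; rewrite LE inE uB.
Qed.

Let exists_glue : exists g : G -> 'I_N,
    {in W &, forall u v, label u = label v -> g u = g v} /\
    {in W &, forall u v, u -- v -> label u <> label v -> g u <> g v}.
Proof.
apply: contr.
  move=> u v uW vW uv.
  have step (e : rel G) : (forall x y, e x y -> [/\ x -- y, x \in L, y \in L & label x = label y]) ->
    connect e u v -> connect (fun a b => [&& a -- b, a \in W, b \in W & label a == label b]) u v.
    move=> eP cuv; have : connect (fun x y => [&& e x y, x \in W & y \in W]) u v.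
      apply: connect_restrict => // x y /eP[_ xL yL xy] xW.
      by apply: W_label xW xL yL _; rewrite xy.
    apply: (connect_mono_map (h := id)) => x y /and3P[/eP[xy _ _ lxy] xW yW].
    by apply: connect1; rewrite xy xW yW lxy eqxx.
  move: (uv); rewrite /label; case wu: (w u) => [a|]; case wv: (w v) => [a'|] //.
    case=> aa'; subst a'; apply: (step (owner_rel w a)).
      move=> x y /and3P[xy /eqP wx /eqP wy]; split=> //; try exact: owner_L wx.
        exact: owner_L wy.
      by rewrite !(label_owner wx, label_owner wy).
    by case: w_valid => _ _; apply.
  case=> /(rootP piece_sym); apply: step => x y /and3P[xy xY yY]; split=> //.
  - by move: xY; rewrite inE => /andP[].
  - by move: yY; rewrite inE => /andP[].
  - exact: label_piece.
(* The minor is proper: a vertex beyond [S] is either deleted or identified with a vertex of [S]. *)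
have [a [aB aS]] := nonempty_side; case: (boolP (a \in W)) => aW; [right|by left; exists a].
have [|s sS sa] := W_S aW; first by rewrite LE inE.
exists s, a; split=> //; first exact: SW.
by apply: contraNneq aS => <-.
Qed.

(** * Recoloring [L] to match the coloring of the minor on [S] *)

Section WithGlue.
Variable g : G -> 'I_N.
Hypothesis g_label : {in W &, forall u v, label u = label v -> g u = g v}.
Hypothesis g_adj : {in W &, forall u v, u -- v -> label u <> label v -> g u <> g v}.
Variable free : 'I_N -> 'I_N.
Hypothesis free_inj : {in g @: I &, injective free}.
Hypothesis freeE : {in g @: I, forall a, free a \in E}.

Let part (r : 'I_N) : {set G} := [set x in R | g x == r].

Let part_indep r : 1 < #|part r| -> part r \in XX.
Proof.
move=> Pr; rewrite inE Pr /=; apply/andP; split.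
  by apply/subsetP => x; rewrite inE => /andP[].
apply/independentP => x y; rewrite !inE => /andP[/RS xS /eqP gx] /andP[/RS yS /eqP gy].
apply/negP => xy; have := g_adj (SW xS) (SW yS) xy; rewrite gx gy; apply=> //.
by move/label_S => /(_ xS yS); apply: cL => //; apply: (subsetP SL).
Qed.

(** The color that the vertices of [S] with [g]-color [r] are to receive. A sole vertex of [R] among
    them keeps its color and those in [I] follow it; if all of them are in [I], a color of [E] is
    taken. *)
Let target (r : 'I_N) : 'I_N :=
  if 1 < #|part r| then b (part r) else if [pick x in part r] is Some x then c x else free r.

Variant target_spec r : 'I_N -> Prop :=
| TargetMany of part r \in XX : target_spec r (b (part r))
| TargetOne x of part r = [set x] & x \in R & g x = r : target_spec r (c x)
| TargetFree of part r = set0 : target_spec r (free r).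

Let targetP r : target_spec r (target r).
Proof.
rewrite /target; case: ifPn => [/part_indep|]; first by constructor.
rewrite -leqNgt => P1; case: pickP => [x xP|P0]; last first.
  by constructor; apply/setP => x; rewrite P0 inE.
have xE := xP; move: xE; rewrite inE => /andP[xR /eqP gx].
apply: TargetOne => //; apply/eqP; rewrite eq_sym eqEcard cards1 P1 andbT.
by rewrite sub1set.
Qed.

Let part_empty r : part r = set0 -> r \in g @: S -> r \in g @: I.
Proof.
move=> P0 /imsetP[s sS rE]; case: (SE sS) => sE; first by rewrite rE imset_f.
by have : s \in part r; [rewrite inE sE rE eqxx | rewrite P0 inE].
Qed.

Let gW u : u \in W -> u \in L -> g u \in g @: S.
Proof.
move=> uW uL; have [s sS su] := W_S uW uL; apply/imsetP; exists s => //.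
by apply: g_label => //; apply: SW.
Qed.

Let owner_W v a : w v = Some a -> v \in W.
Proof.
move=> wv; have [y yR cy] := T_in (owner_R wv).
apply: (W_label (SW (RS yR))); first exact: (subsetP SL _ (RS yR)).
  exact: owner_L wv.
by rewrite (label_owner wv) (label_owner (owner_part yR)) cy.
Qed.

Let g_owner v a y : w v = Some a -> y \in R -> c y = a -> g y = g v.
Proof.
move=> wv yR cy; apply: g_label; [exact: SW (RS yR)|exact: owner_W wv|].
by rewrite (label_owner wv) (label_owner (owner_part yR)) cy.
Qed.

Let T_part v a : w v = Some a -> T a \subset part (g v).
Proof.
move=> wv; apply/subsetP => y; rewrite !inE => /andP[yR /eqP cy].
by rewrite yR (g_owner wv yR cy) eqxx.
Qed.

Let g_subset v a r : w v = Some a -> T a \subset part r -> g v = r.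
Proof.
move=> wv /subsetP TP; have [y yR cy] := T_in (owner_R wv).
have := TP y; rewrite !inE yR cy eqxx (g_owner wv yR cy) => /(_ isT).
by move/eqP.
Qed.

(** The three kinds of targets come from the disjoint sets [b @: XX], [c @: R] and [E]. In the
    second, equal colors under [c] on [R] mean the same owned set, hence equal colors under [g]. *)
Let target_inj : {in g @: S &, injective target}.
Proof.
move=> r r' rS r'S; case: targetP => [XXr|x Px xR gx|P0]; case: targetP => [XXr'|x' Px' x'R gx'|P0'].
- move/(b_inj XXr XXr') => PE; have : 0 < #|part r|.
    by apply: ltn_trans (_ : 0 < 1) _ => //; case/setIdP: XXr => _ /andP[].
  case/card_gt0P => y yP; move: (yP); rewrite {1}PE !inE in yP *.
  by case/andP: yP => _ /eqP <- /andP[_ /eqP].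
- by move=> bE; have := bR XXr; rewrite bE imset_f.
- by move=> bE; have := Eb XXr; rewrite bE freeE ?part_empty.
- by move=> bE; have := bR XXr'; rewrite -bE imset_f.
- move=> cx; rewrite -gx -gx'; apply: g_owner cx => //; exact: owner_part.
- by move=> fE; have := ER (freeE (part_empty P0' r'S)); rewrite -fE imset_f.
- by move=> bE; have := Eb XXr'; rewrite -bE freeE ?part_empty.
- by move=> fE; have := ER (freeE (part_empty P0 rS)); rewrite fE imset_f.
- by apply: free_inj; apply: part_empty.
Qed.

(** The color under [c] of the vertices of [S] in the fiber of [v]. An unowned fiber in [L] can meet
    [S] only in [I], hence the value [i0]. *)
Let home (v : G) : 'I_N := if w v is Some a then a else i0.

(* Every fiber is closed under Kempe changes between its home and target colors. *)
Let boundary_color u v : u \in W -> u \in L -> v \in L -> u -- v -> label u <> label v ->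
  c v <> home u /\ c v <> target (g u).
Proof.
move=> uW uL vL uv luv; rewrite /home.
case wu: (w u) => [a|].
  have nadm : admissible c R XX b a v -> exists2 l, w v = Some l & l <> a.
    move=> adm; case wv: (w v) => [l|]; last by case: (w_closed wu uv vL adm wv).
    exists l => // la; apply: luv; rewrite (label_owner wu) (label_owner wv).
    by rewrite la.
  have cva : c v <> a.
    move=> cv; have [|l wv] := nadm; first by rewrite /admissible cv eqxx.
    by rewrite (owner_own wv) ?cv // (owner_R wu).
  split=> //; case: targetP => [XXr cv|x Px xR gx|P0].
  (* The color of [v] is admissible for V_a because T_a lies in [part (g u)]. So [v] is owned by
     some V_l with T_l in the same part, which gives [g v = g u], against [g_adj]. *)
  - have [|l wv _] := nadm.
      apply/orP; right; apply/existsP; exists (part (g u)).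
      by rewrite XXr cv eqxx T_part.
    apply: (g_adj uW (owner_W wv) uv luv); apply/esym; apply: (g_subset wv _).
    exact: owner_b wv XXr cv.
  - have [y yR cy] := T_in (owner_R wu).
    have := subsetP (T_part wu) y; rewrite Px !inE yR cy eqxx => /(_ isT)/eqP yx.
    by rewrite -yx cy.
  - have [y yR cy] := T_in (owner_R wu).
    by have := subsetP (T_part wu) y; rewrite P0 !inE yR cy eqxx => /(_ isT).
have uY : u \in Y by rewrite inE uL wu eqxx.
case wv: (w v) => [l|]; last first.
  by case: luv; apply: label_piece => //; rewrite inE vL wv eqxx.
have guv := g_adj uW (owner_W wv) uv luv.
split; first exact: owner_i0 wv.
case: targetP => [XXr cv|x Px xR gx cv|P0 cv].
- by apply: guv; apply/esym; apply: (g_subset wv _); apply: owner_b wv XXr cv.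
- apply: guv; rewrite -gx; apply: (g_owner wv xR _).
  by rewrite -cv (owner_own wv) // cv imset_f.
- by have := owner_E wv; rewrite cv freeE // part_empty // gW.
Qed.

Let home_target u v : u \in W -> u \in L -> v \in W -> v \in L -> u -- v ->
  label u <> label v -> home u <> target (g v).
Proof.
move=> uW uL vW vL uv luv; have guv := g_adj uW vW uv luv.
rewrite /home; case wu: (w u) => [a|].
  case: targetP => [XXr aE|x Px xR gx aE|P0 aE].
  - by have := bR XXr; rewrite -aE (owner_R wu).
  - by apply: guv; rewrite -gx; apply/esym; apply: g_owner wu xR _.
  - by have := ER (freeE (part_empty P0 (gW vW vL))); rewrite -aE (owner_R wu).
case: targetP => [/bi0 + /esym //|x Px xR gx /esym|P0 _]; first exact: cR.
(* [i0] may belong to [E], so colors alone do not decide this case: an empty part leaves [v]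
   unowned, and then [u] and [v] lie in one component. *)
case wv: (w v) => [l|].
  have [y yR cy] := T_in (owner_R wv).
  by have := subsetP (T_part wv) y; rewrite P0 !inE yR cy eqxx => /(_ isT).
by apply: luv; apply: label_piece => //; rewrite inE ?uL ?vL ?wu ?wv.
Qed.

Let home_neq u v : u \in L -> v \in L -> u -- v -> label u <> label v -> home u <> home v.
Proof.
move=> uL vL uv luv; rewrite /home; case wu: (w u) => [a|]; case wv: (w v) => [a'|].
- by move=> aa'; apply: luv; rewrite (label_owner wu) (label_owner wv) aa'.
- by move=> aE; have := i0R; rewrite -aE (owner_R wu).
- by move=> aE; have := i0R; rewrite aE (owner_R wv).
- by case: luv; apply: label_piece => //; rewrite inE ?uL ?vL ?wu ?wv.
Qed.

(** All Kempe changes are made at once, one per fiber. On [S] the old color is the home color, so it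
    becomes the target. *)
Let recolor (v : G) : 'I_N := if v \in W then tperm (home v) (target (g v)) (c v) else c v.

Let recolor_proper u v : u \in L -> v \in L -> u -- v -> recolor u <> recolor v.
Proof.
move=> uL vL uv; have vu : v -- u by rewrite adj_sym.
have cuv := cL uL vL uv.
have half x y : x \in L -> y \in L -> x -- y -> x \in W -> y \notin W -> recolor x <> recolor y.
  move=> xL yL xy xW yW; rewrite /recolor xW (negPf yW).
  have lxy : label x <> label y.
    by move=> lxy; case/negP: yW; apply: (W_label xW xL yL _).
  have [cyh cyt] := boundary_color xW xL yL xy lxy.
  have cxy := cL xL yL xy.
  by case: tpermP => *; congruence.
case: (boolP (u \in W)) => uW; case: (boolP (v \in W)) => vW.
- rewrite /recolor uW vW; case: (eqVneq (label u) (label v)) => [luv|/eqP luv].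
    have -> : home u = home v.
      by move: luv; rewrite /home /label; case: (w u) => [a|]; case: (w v) => [a'|] // [].
    by rewrite (g_label uW vW luv) => /perm_inj.
  have lvu : label v <> label u by move/esym.
  have [h1 h2] := boundary_color uW uL vL uv luv.
  have [h3 h4] := boundary_color vW vL uL vu lvu.
  apply: tperm_neq => //; first exact: home_neq.
  + exact: home_target.
  + by move/esym; apply: home_target.
  + by move/target_inj => /(_ (gW uW uL) (gW vW vL)); apply: g_adj.
- exact: half.
- by move/esym; apply: half.
- by rewrite /recolor (negPf uW) (negPf vW).
Qed.

Let recolor_S s : s \in S -> recolor s = target (g s).
Proof.
move=> sS; rewrite /recolor SW //.
have -> : c s = home s; last by rewrite tpermL.
by rewrite /home; case: (SE sS) => sE; rewrite ?(owner_I sE) ?(owner_part sE) // cI.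
Qed.

Lemma glued_coloring : colorable N G.
Proof.
(* Renaming the colors of [g] on [B] by [p] makes the two sides agree on [S]. *)
have [p pE] := perm_extending target_inj.
pose col v := if v \in B then p (g v) else recolor v.
have half u v : u -- v -> u \in B -> v \notin B -> col u <> col v.
  move=> uv uB vB; rewrite /col uB (negPf vB).
  case: (boolP (v \in S)) => vS; last by have := separated uB vB vS; rewrite uv.
  rewrite recolor_S // -pE ?imset_f // => /perm_inj; apply: g_adj => //.
  - by rewrite !inE uB.
  - exact: SW.
  - by move/label_B => /(_ uB) uvE; rewrite uvE adj_irrefl in uv.
apply/existsP; exists [ffun v => col v]; apply/forallP => u; apply/forallP => v.
apply/implyP => uv; rewrite !ffunE; apply/eqP.
case: (boolP (u \in B)) => uB; case: (boolP (v \in B)) => vB.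
- rewrite /col uB vB => /perm_inj; apply: g_adj; rewrite ?inE ?uB ?vB //.
  by move/label_B => /(_ uB) uvE; rewrite uvE adj_irrefl in uv.
- exact: half.
- by move/esym; apply: half => //; rewrite adj_sym.
- by rewrite /col (negPf uB) (negPf vB); apply: recolor_proper => //; rewrite LE inE.
Qed.

End WithGlue.

Lemma owned_coloring : colorable N G.
Proof.
have [g [g_label g_adj]] := exists_glue.
have [|free [free_inj freeE]] := @injection_into _ _ (g @: I) E i0.
  exact: leq_trans (leq_imset_card _ _) cardE.
exact: (glued_coloring g_label g_adj free_inj freeE).
Qed.

End WithColoring.

(** At most |R| colors occur on [R]. Of the others, one different from [i0] is reserved for each
    independent set, and the rest, at least |I| many, form [E]. The [maxn 1] leaves room for [i0]
    when [I] is empty. *)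
Lemma separator_coloring (c0 : {ffun G -> 'I_N}) : exact_coloring c0 ->
  #|R| + maxn 1 #|I| + #|independent_sets R| <= N -> colorable N G.
Proof.
move=> c0_exact count.
pose c := [arg max_(c > c0 | exact_coloring c) #|c @: R|].
have [c_exact c_max] : exact_coloring c /\
    forall c', exact_coloring c' -> #|c' @: R| <= #|c @: R|.
  by rewrite /c; case: arg_maxnP.
have [_ _ cR] := exact_coloringP _ c_exact.
have i0R : i0 \notin c @: R by apply/imsetP => -[x /cR + E']; rewrite -E'.
have cardR : #|R| + #|~: (c @: R)| >= N.
  by rewrite -[X in X <= _]card_ord -(cardsC (c @: R)) leq_add2r leq_imset_card.
have [|b [b_inj bF]] := @injection_into _ _ (independent_sets R) (~: (c @: R) :\ i0) i0.
  move: cardR count; rewrite (cardsD1 i0) inE i0R; have := leq_maxl 1 #|I|; lia.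
pose E := ~: (c @: R) :\: (b @: independent_sets R).
have cardE : #|I| <= #|E|.
  have := leq_imset_card b (independent_sets R).
  have := cardsID (b @: independent_sets R) (~: (c @: R)).
  have := subset_leq_card (subsetIr (~: (c @: R)) (b @: independent_sets R)).
  by move: cardR count; rewrite -/E; have := leq_maxr 1 #|I|; lia.
have RL : R \subset L.
  by apply/subsetP => x /RS; apply: (subsetP SL).
have [w [w_valid w_closed]] := @exists_owner _ _ c L R (independent_sets R) b RL.
apply: (@owned_coloring c c_exact c_max b E _ _ _ _ _ cardE w w_valid w_closed) => //.
- by move=> X /bF; rewrite !inE => /andP[].
- by move=> X /bF; rewrite !inE => /andP[/eqP].
- by move=> a; rewrite !inE => /andP[].
- by move=> X XX; rewrite !inE negb_and negbK imset_f.
Qed.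

End Gluing.

(** * Counting independent sets and separators *)

Lemma card_subsets_sizes (T : finType) (A : {set T}) (s : seq nat) :
  #|[set X : {set T} | (X \subset A) && (#|X| \in s)]| <= sumn [seq 'C(#|A|, j) | j <- s].
Proof.
elim: s => [|j s IHs] /=; first by rewrite eq_card0 // => X; rewrite !inE andbF.
rewrite -cards_draws; apply: leq_trans (leq_add (leqnn _) IHs).
apply: leq_trans (subset_leq_card _) (leq_card_setU _ _).
by apply/subsetP => X; rewrite !inE -andb_orr.
Qed.

(** The sizes run from 2 to [a] in the first sum, and from 1 to [a - 1] in the second, where one
    element has been removed. *)
Definition sets_bound n a :=
  sumn [seq 'C(n.-1, j) | j <- iota 2 a.-1] + sumn [seq 'C(n.-2, j) | j <- iota 1 a.-1].

(* The independent sets avoiding [u] are counted by the first sum of [sets_bound]; those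
   containing [u] avoid its neighbor [v] and are counted by the second one. *)
Lemma card_independent_sets (G : sgraph) (R : {set G}) (a : nat) (u v : G) :
  u \in R -> v \in R -> u -- v ->
  (forall X : {set G}, X \subset R -> independent X -> #|X| <= a) ->
  #|independent_sets R| <= sets_bound #|R| a.
Proof.
move=> uR vR uv Ra; have uNv : u != v by apply: contraTneq uv => ->; rewrite adj_irrefl.
have cardu : #|R :\ u| = #|R|.-1 by rewrite (cardsD1 u R) uR.
have carduv : #|R :\ u :\ v| = #|R|.-2.
  by rewrite -cardu (cardsD1 v (R :\ u)) !inE vR eq_sym uNv.
rewrite /sets_bound -carduv -cardu.
have := leq_add (card_subsets_sizes (R :\ u) (iota 2 a.-1))
                (card_subsets_sizes (R :\ u :\ v) (iota 1 a.-1)).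
apply: leq_trans.
apply: (@leq_trans #|[set X : {set G} | (X \subset R :\ u) && (#|X| \in iota 2 a.-1)]
   :|: (fun X : {set G} => u |: X) @:
   [set X : {set G} | (X \subset R :\ u :\ v) && (#|X| \in iota 1 a.-1)]|).
  apply: subset_leq_card; apply/subsetP => X; rewrite inE => /and3P[XR X1 Xind].
  have Xa := Ra _ XR Xind; have /independentP Xi := Xind.
  rewrite in_setU; case: (boolP (u \in X)) => uX; apply/orP; [right|left].
    apply/imsetP; exists (X :\ u); last by rewrite setD1K.
    rewrite inE !subsetD1 setD11 !inE !negb_and negbK.
    have -> /= : v \notin X by apply: contraTN uv => vX; apply: Xi.
    rewrite orbT andbT (subset_trans (subD1set _ _) XR) /= mem_iota.
    by move: X1 Xa; rewrite (cardsD1 u X) uX; lia.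
  by rewrite inE subsetD1 XR uX mem_iota; move: X1 Xa; lia.
apply: leq_trans (leq_card_setU _ _) _; rewrite leq_add2l.
exact: leq_imset_card.
Qed.

(** A boolean, to be decided by computation, with [n] and [a] the sizes of [R] and [I]. The term
    [2 ^ n] serves an independent [R], for which [n <= a] by the choice of [I]; otherwise [R]
    contains an edge and [sets_bound] applies. *)
Definition enough_colors m N :=
  all (fun n => all (fun a => (n + a < m) ==>
     ((n <= a) ==> (n + maxn 1 a + 2 ^ n <= N))
     && (n + maxn 1 a + sets_bound n a <= N)) (iota 0 m)) (iota 0 m).

Lemma enough_colorsP m N n a : enough_colors m N -> n + a < m ->
  (n <= a -> n + maxn 1 a + 2 ^ n <= N) /\ n + maxn 1 a + sets_bound n a <= N.
Proof.
move=> /allP/(_ n) H nam; have /H/allP/(_ a) Ha : n \in iota 0 m by rewrite mem_iota; lia.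
have /Ha : a \in iota 0 m by rewrite mem_iota; lia.
by rewrite nam => /andP[/implyP].
Qed.

Lemma split_separator (G : sgraph) m N (S : {set G}) : enough_colors m N -> #|S| < m ->
  exists I : {set G}, [/\ I \subset S, independent I, S != set0 -> I != set0
    & #|S :\: I| + maxn 1 #|I| + #|independent_sets (S :\: I)| <= N].
Proof.
move=> mN Sm; pose P (X : {set G}) := (X \subset S) && independent X.
have P0 : P set0 by rewrite /P sub0set; apply/independentP => u v; rewrite inE.
case: (arg_maxnP (fun X : {set G} => #|X|) P0) => I /andP[IS Iind] Imax.
have cardS : #|S :\: I| + #|I| = #|S| by rewrite -(cardsID I S) (setIidPr IS) addnC.
have [n1 n2] : (#|S :\: I| <= #|I| -> #|S :\: I| + maxn 1 #|I| + 2 ^ #|S :\: I| <= N) /\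
    #|S :\: I| + maxn 1 #|I| + sets_bound #|S :\: I| #|I| <= N.
  by apply: enough_colorsP mN _; rewrite cardS.
exists I; split=> // [/set0Pn[x xS]|].
  have : #|[set x]| <= #|I|.
    apply: Imax; rewrite /P sub1set xS; apply/independentP => u v.
    by rewrite !inE => /eqP-> /eqP->; rewrite adj_irrefl.
  by rewrite cards1 card_gt0.
have Imax' (X : {set G}) : X \subset S :\: I -> independent X -> #|X| <= #|I|.
  by move=> XR Xind; apply: Imax; rewrite /P Xind (subset_trans XR) ?subsetDl.
case: (boolP (independent (S :\: I))) => [Rind|/forall_inPn[u uR /forall_inPn[v vR /negbNE uv]]].
  apply: leq_trans (n1 (Imax' _ (subxx _) Rind)); rewrite leq_add2l.
  rewrite -card_powerset; apply: subset_leq_card; apply/subsetP => X.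
  by rewrite !inE => /and3P[].
by apply: leq_trans n2; rewrite leq_add2l; apply: card_independent_sets uR vR uv Imax'.
Qed.

(** * Minimum separators *)

Definition avoid_rel (G : sgraph) (S : {set G}) : rel G :=
  fun u v => [&& u -- v, u \notin S & v \notin S].

Lemma delete_connected (G : sgraph) (S : {set G}) : #|S| < #|G| ->
  (forall x y, x \notin S -> y \notin S -> connect (avoid_rel S) x y) -> connected (delete S).
Proof.
move=> SG Sconn; split.
  have /card_gt0P[x xS] : 0 < #|~: S| by rewrite -(cardsC S) in SG; lia.
  by apply/card_gt0P; exists (Sub x (etrans (esym (in_setC _ _)) xS)).
move=> x y; have := Sconn _ _ (valP x) (valP y).
pose h z : delete S := insubd x z.
have hK z : h (val z) = z by rewrite /h valKd.
move=> xy; rewrite -(hK x) -(hK y); apply: connect_mono_map xy.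
move=> u v /and3P[uv uS vS]; apply: connect1.
by rewrite /= /delete_adj /h !insubdK.
Qed.

(** [S] is a separator of least size and [B] a component of its complement. A vertex of [S] without
    a neighbor in [B] could be dropped from [S], against minimality. *)
Lemma minimal_separator (G : sgraph) (S0 : {set G}) x0 y0 :
  x0 \notin S0 -> y0 \notin S0 -> ~~ connect (avoid_rel S0) x0 y0 ->
  exists B S : {set G}, [/\ #|S| <= #|S0|, [disjoint B & S],
    (forall u v, u \in B -> v \notin B -> v \notin S -> ~~ (u -- v)),
    (exists a, a \notin B /\ a \notin S)
  & exists y, [/\ y \in B,
      (forall u, u \in B -> connect (fun u v => [&& u -- v, u \in B & v \in B]) y u)
    & (forall z, z \in S -> exists2 v, v \in B & z -- v)]].
Proof.
move=> x0S y0S nxy.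
pose sep (S : {set G}) := [exists x, exists y,
  [&& x \notin S, y \notin S & ~~ connect (avoid_rel S) x y]].
have sep0 : sep S0.
  by apply/existsP; exists x0; apply/existsP; exists y0; rewrite x0S y0S nxy.
case: (arg_minnP (fun S : {set G} => #|S|) sep0) => S /existsP[x /existsP[y]].
move=> /and3P[xS yS nc] Smin.
have sym (U : {set G}) : connect_sym (avoid_rel U).
  by apply: sym_connect_sym => u v; rewrite /avoid_rel adj_sym [(u \notin U) && _]andbC.
pose B := [set v | connect (avoid_rel S) y v].
have BS v : v \in B -> v \notin S.
  rewrite inE => yv; apply/negP => vS.
  have [|a [b [_ /and3P[_ _ bS]]]] := connect_exit (P := fun v => v \notin S) yv yS _.
    by rewrite negbK.
  by rewrite bS.
have xB : x \notin B by rewrite inE sym.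
have yB : y \in B by rewrite inE connect0.
have step u v : u \in B -> u -- v -> v \notin S -> v \in B.
  move=> uB uv vS; have uS := BS _ uB; move: uB; rewrite !inE => yu.
  by apply: connect_trans yu (connect1 _); rewrite /avoid_rel uv uS vS.
exists B, S; split.
- exact: Smin.
- by apply/pred0P => v; apply/negbTE/negP => /andP[/BS/negPf vS]; rewrite /= vS.
- by move=> u v uB vB vS; apply: contra vB => uv; apply: step uB uv vS.
- by exists x.
exists y; split=> //.
  move=> u; rewrite inE => yu.
  have : connect (fun a b => [&& avoid_rel S a b, a \in B & b \in B]) y u.
    apply: (connect_restrict (P := mem B)) => // a b /and3P[ab _ bS] aB; exact: step aB ab bS.
  apply: (connect_mono_map (h := id)) => a b /and3P[/and3P[ab _ _] aB bB].
  by apply: connect1; rewrite ab aB bB.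
move=> z zS; case: (boolP [exists v in B, z -- v]) => [/exists_inP//|/exists_inPn nz].
suff : sep (S :\ z) by move/Smin; rewrite (cardsD1 z S) zS ltnn.
apply/existsP; exists y; apply/existsP; exists x.
rewrite !inE (negPf yS) (negPf xS) !andbF /=; apply/negP => yx.
have [a [b [_ /and3P[ab aS bS] aB bB]]] := connect_exit (P := mem B) yx yB xB.
move: bS; rewrite !inE negb_and negbK => /orP[/eqP bz|bS].
  by have := nz a aB; rewrite adj_sym -bz ab.
by case/negP: bB; apply: step aB ab bS.
Qed.

(** * Connectivity of critical graphs *)

Lemma critical_m_connected k m N (G : sgraph) : contraction_critical k G ->
  enough_colors m N -> 0 < N <= k.-1 -> m < k -> m_connected m G.
Proof.
move=> crit mN /andP[N0 Nk] mk; have k0 : 0 < k.-1 by apply: leq_trans N0 Nk.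
have contr := critical_contraction_colorable crit k0.
have minimal n : colorable n G -> k <= n.
  by case: crit => <- _; rewrite /chromatic_number; case: ex_minnP => ? _; apply.
have ncol : ~ colorable k.-1 G by move/minimal; lia.
have kG : k <= #|G|.
  apply: minimal; apply/existsP; exists [ffun x => enum_rank x].
  apply/forallP => x; apply/forallP => y; apply/implyP; rewrite !ffunE.
  by apply: contraTneq => /enum_rank_inj->; rewrite adj_irrefl.
split; first exact: leq_trans mk kG.
move=> S0 S0m; apply: delete_connected => [|x0 y0 x0S y0S]; first by lia.
apply/negPn/negP => nxy; case: ncol.
have [B [S [SS0 BS sepB side [y [yB Bconn SB]]]]] := minimal_separator x0S y0S nxy.
have [I [IS /independentP Iind I0 count]] := split_separator mN (leq_ltn_trans SS0 S0m).
have i0 : 'I_k.-1 by exists 0.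
have [c0 [j c0E]] : exists (c0 : {ffun G -> 'I_k.-1}) j, exact_coloring (~: B) (S :\: I) I j c0.
  (* With [S] empty there is no vertex of [I] to merge with [B], so [B] is deleted instead and any
     [i0] serves. *)
  have [S0E|Sn0] := eqVneq S set0.
    have [||g [_ g_adj]] := contr G (~: B) id.
    - by move=> u v _ _ ->.
    - by left; exists y; rewrite inE negbK.
    exists [ffun v => g v], i0; apply/exact_coloringP; split=> [u v uB vB uv|z|z].
    - rewrite !ffunE; apply: (g_adj _ _ uB vB uv) => uvE.
      by rewrite uvE adj_irrefl in uv.
    - by move/(subsetP IS); rewrite S0E inE.
    - by rewrite S0E set0D inE.
  have /set0Pn[x xI] := I0 Sn0.
  (* [B] and [I] together become [None]; their union is connected because every vertex of [I] has a
     neighbor in [B]. Vertices of [R] have one too, so they avoid the color [g y] of the merged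
     vertex. *)
  pose f v : option G := if v \in B :|: I then None else Some v.
  have fN v : v \in B -> f v = None by rewrite /f inE => ->.
  have fI v : v \in I -> f v = None by rewrite /f inE orbC => ->.
  have fS v : v \notin B -> v \notin I -> f v = Some v.
    by rewrite /f inE => /negPf-> /negPf->.
  pose r := fun a b : G => [&& a -- b, a \in [set: G], b \in [set: G] & f a == f b].
  have rsym : connect_sym r.
    apply: sym_connect_sym => u v; rewrite /r !inE /= adj_sym; congr (_ && _).
    by rewrite eq_sym.
  have yr v : f v = None -> connect r y v.
    have yrB u : u \in B -> connect r y u.
      move/Bconn; apply: (connect_mono_map (h := id)) => a b /and3P[ab aB bB].
      by apply: connect1; rewrite /r ab !inE !fN.
    rewrite /f; case: ifP => // /setUP[vB _|vI _]; first exact: yrB.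
    have [u uB vu] := SB _ (subsetP IS _ vI).
    apply: connect_trans (yrB _ uB) (connect1 _).
    by rewrite /r adj_sym vu !inE fN // fI.
  have yI : y \notin I.
    apply: contraTN yB => /(subsetP IS) yS; move/disjointFl: BS => /(_ _ yS).
    by move->.
  have [||g [g_f g_adj]] := contr _ setT f.
  - move=> u v _ _; case fu: (f u) => [u'|] fv.
      move: fu fv; rewrite /f; case: ifP => // _ [<-]; case: ifP => // _ [->].
      exact: connect0.
    by apply: connect_trans (yr _ (esym fv)); rewrite rsym; apply: yr.
  - right; exists x, y; split; rewrite ?inE //; last by rewrite fI ?fN.
    by apply: contraNneq yI => <-.
  exists [ffun v => g v], (g y); apply/exact_coloringP; split=> [u v|z zI|z].
  - rewrite !inE !ffunE => uB vB uv; apply: g_adj; rewrite ?inE //.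
    case: (boolP (u \in I)) => uI; case: (boolP (v \in I)) => vI.
    + by have := Iind _ _ uI vI; rewrite uv.
    + by rewrite fI ?fS.
    + by rewrite fS ?fI.
    + by rewrite !fS // => -[uvE]; rewrite uvE adj_irrefl in uv.
  - by rewrite ffunE; apply: g_f; rewrite ?inE // fI ?fN.
  - case/setDP=> zS zI; rewrite ffunE; have [u uB zu] := SB _ zS.
    have zB : z \notin B by move/disjointFl: BS => /(_ _ zS) ->.
    rewrite -(g_f u y) ?inE ?fN //; apply: g_adj; rewrite ?inE //.
    by rewrite (fN u) ?fS.
apply: (separator_coloring contr sepB erefl erefl BS IS side c0E).
exact: leq_trans count Nk.
Qed.

Theorem theorem1p3 :
  (forall (k : nat) (G : sgraph), contraction_critical k G ->
     [/\ 17 <= k -> m_connected 8 G,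
         29 <= k -> m_connected 9 G
       & 41 <= k -> m_connected 10 G])
  /\ (forall k : nat,
     [/\ 17 <= k -> h_ge k 8,
         29 <= k -> h_ge k 9
       & 41 <= k -> h_ge k 10]).
Proof.
have main k (G : sgraph) : contraction_critical k G ->
     [/\ 17 <= k -> m_connected 8 G,
         29 <= k -> m_connected 9 G
       & 41 <= k -> m_connected 10 G].
  (* The color counts are [k - 1] for the least [k] of each range. For [m = 8] all 16 are needed at
     |R| = 5, |I| = 2, where the bound is 5 + 2 + 9. *)
  by move=> crit; split=> kk; [apply: (critical_m_connected (N := 16) crit)
    | apply: (critical_m_connected (N := 28) crit)
    | apply: (critical_m_connected (N := 40) crit)]; try lia; vm_compute.
split=> // k; split=> kk G crit _; have [H8 H9 H10] := main k G crit;
  by [apply: H8 | apply: H9 | apply: H10].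
Qed.
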